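(* Let $H=(H_d)_{d\in\mathbb{Z}}$ be a homology theory (as specified in the context). Let $X$ be a topological space and $f\colon X\to\mathbb{R}$ a continuous function whose sublevel set filtration $(f_{\le t})_{t\in\mathbb{R}}$ is compact and weakly locally homologically small (weakly LHS) with respect to $H$. Then the sublevel set filtration of $f$ is q-tame with respect to $H$, i.e. for all $d\in\mathbb{Z}$ and all real $s<t$ the linear map $H_d(f_{\le s})\to H_d(f_{\le t})$ induced by inclusion has finite rank.
   Context: Fix a field $\mathbb{F}$. A homology theory here is a family $H=(H_d)_{d\in\mathbb{Z}}$ of homotopy invariant functors from topological spaces to $\mathbb{F}$-vector spaces (homotopic maps induce equal linear maps) such that: (i) $H$ has the open or the compact Mayer--Vietoris property. A triple $X_1,X_2\subseteq X$ has a Mayer--Vietoris sequence if the inclusion-induced maps can be completed to a long exact sequence $\cdots\to H_{n+1}(X)\to H_n(X_1\cap X_2)\to H_n(X_1)\oplus H_n(X_2)\to H_n(X)\to H_{n-1}(X_1\cap X_2)\to\cdots$. The open (resp. compact) Mayer--Vietoris property says that there are natural Mayer--Vietoris sequences for all triples $X_1,X_2\subseteq X$ with $X=X_1\cup X_2$ and each $X_i\subseteq X$ open (resp. compact Hausdorff); (ii) there is $n_0$ with $H_n=0$ for all $n\le n_0$; (iii) each $H_n$ takes finite dimensional values on one-point spaces. For $f\colon X\to\mathbb{R}$ write $f_{\le t}=f^{-1}(-\infty,t]$ (subspace topology). The sublevel set filtration is compact if every $f_{\le t}$ is a compact Hausdorff space. A continuous map is homologically small (HS) if the map it induces on $H_n$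 has finite dimensional image for every $n\in\mathbb{Z}$. The sublevel set filtration of $f$ is weakly locally homologically small (weakly LHS) if for any $x\in X$, any neighborhood $V$ of $x$, and any $t>f(x)$, there are an index $s$ with $f(x)<s<t$ and a neighborhood $U$ of $x$ with $U\subseteq V$ such that the inclusion $f_{\le s}\cap U\hookrightarrow f_{\le t}\cap V$ is HS.
   Formalization: The homology theory is additionally required to take finite dimensional values on the empty space in every degree; without this the statement fails (augmented singular homology with infinite dimensional coefficients, f = 0 on two discrete points). *)

(* Defs.v *)
From HB Require Import structures.
From mathcomp Require Import all_boot all_order all_algebra.
From mathcomp Require Import all_classical all_reals all_analysis.
Set Implicit Arguments.
Unset Strict Implicit.
Unset Printing Implicit Defensive.
Import Order.TTheory GRing.Theory Num.Theory.
Import numFieldNormedType.Exports.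
Local Open Scope classical_set_scope.
Local Open Scope ring_scope.

(* A set [A : set X] used as a type is the subspace [set_type A], carrying the
   initial topology of [set_val : A -> X]. *)
Section subspaces.
Context {X Y : topologicalType}.

Lemma set_val_continuous (A : set X) : continuous (@set_val X A).
Proof. exact: (@initial_continuous A X set_val). Qed.

HB.instance Definition _ (A : set X) :=
  isContinuous.Build A X (@set_val X A) (@set_val_continuous A).

Variables (A : set X) (B : set Y) (f : continuousType X Y).
Hypothesis fAB : A `<=` f @^-1` B.

Definition restr_map (a : A) : B :=
  exist _ (f (set_val a)) (mem_set (fAB (set_mem (valP a)))).

Lemma restr_map_continuous : continuous restr_map.
Proof.
apply: (@continuous_comp_initial B A Y set_val restr_map) => a.
apply: (@continuous_comp _ _ _ set_val f a);
  [exact: (@set_val_continuous A a) | exact: cts_fun].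
Qed.

HB.instance Definition _ :=
  isContinuous.Build A B restr_map restr_map_continuous.

End subspaces.

Definition incl_map (X : topologicalType) (A B : set X) (AB : A `<=` B) :
  continuousType A B := @restr_map X X A B idfun AB.

Definition compact_hausdorff (T : topologicalType) : Prop :=
  compact [set: T] /\ hausdorff_space T.

Definition homotopic (R : realType) (X Y : topologicalType)
    (f g : continuousType X Y) : Prop :=
  exists h : X * R -> Y,
    [/\ {within [set: X] `*` `[0, 1], continuous h},
        forall x, h (x, 0) = f x & forall x, h (x, 1) = g x].

Section linear_algebra.
Variable F : fieldType.

(* [lmodType] may be infinite dimensional: [S] is a finite dimensional subspace
   when it is the linear span of a finite family. *)
Definition finite_dimensional (V : lmodType F) (S : set V) : Prop :=
  exists (n : nat) (v : 'I_n -> V),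
    S = range (fun c : 'I_n -> F => \sum_(i < n) c i *: v i).

Definition finite_rank (U V : lmodType F) (phi : {linear U -> V}) : Prop :=
  finite_dimensional (range phi).

Definition exact_at (U V W : lmodType F) (phi : U -> V) (psi : V -> W) : Prop :=
  range phi = [set v | psi v = 0].

End linear_algebra.

Record top_functors (F : fieldType) := TopFunctors {
  hobj :> int -> topologicalType -> lmodType F;
  hmap : forall (d : int) (X Y : topologicalType),
    continuousType X Y -> {linear hobj d X -> hobj d Y};
  hmap_id : forall (d : int) (X : topologicalType) (u : hobj d X),
    hmap d (@idfun X) u = u;
  hmap_comp : forall (d : int) (X Y Z : topologicalType)
      (f : continuousType X Y) (g : continuousType Y Z) (u : hobj d X),
    hmap d (g \o f) u = hmap d g (hmap d f u)
}.

Section mayer_vietoris.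
Variables (F : fieldType) (H : top_functors F).

Definition mv_diag (X : topologicalType) (A B : set X) (n : int)
    (u : H n (A `&` B)) : H n A * H n B :=
  (hmap H n (incl_map (@subIsetl X A B)) u,
   hmap H n (incl_map (@subIsetr X A B)) u).

Definition mv_diff (X : topologicalType) (A B : set X) (n : int)
    (w : H n A * H n B) : H n X :=
  hmap H n (@set_val X A) w.1 - hmap H n (@set_val X B) w.2.

(* Connecting maps are given for all triples, but they are constrained only on
   those satisfying [mv_triple P]; elsewhere they may be taken to be 0. *)
Definition connecting_maps : Type :=
  forall (X : topologicalType) (A B : set X) (n : int),
    {linear H (n + 1) X -> H n (A `&` B)}.

Definition mv_exact (X : topologicalType) (A B : set X)
    (delta : forall n : int, {linear H (n + 1) X -> H n (A `&` B)}) : Prop :=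
  forall n : int,
    [/\ exact_at (@mv_diag X A B n) (@mv_diff X A B n),
        exact_at (@mv_diff X A B (n + 1)) (delta n) &
        exact_at (delta n) (@mv_diag X A B n)].

Definition mv_triple (P : forall X : topologicalType, set X -> Prop)
    (X : topologicalType) (A B : set X) : Prop :=
  [/\ A `|` B = [set: X], P X A & P X B].

Lemma setI_preimage (X Y : Type) (A B : set X) (C D : set Y) (f : X -> Y) :
  A `<=` f @^-1` C -> B `<=` f @^-1` D -> A `&` B `<=` f @^-1` (C `&` D).
Proof. by move=> fA fB x [/fA ? /fB]. Qed.

Definition mv_natural (P : forall X : topologicalType, set X -> Prop)
    (delta : connecting_maps) : Prop :=
  forall (X Y : topologicalType) (A B : set X) (C D : set Y)
    (f : continuousType X Y) (fA : A `<=` f @^-1` C) (fB : B `<=` f @^-1` D),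
    mv_triple P A B -> mv_triple P C D ->
    forall (n : int) (u : H (n + 1) X),
      delta Y C D n (hmap H (n + 1) f u) =
      hmap H n (restr_map (setI_preimage fA fB)) (delta X A B n u).

Definition mv_property (P : forall X : topologicalType, set X -> Prop) : Prop :=
  exists delta : connecting_maps,
    (forall (X : topologicalType) (A B : set X),
       mv_triple P A B -> mv_exact (delta X A B)) /\
    mv_natural P delta.

Definition open_mv : Prop := mv_property (fun X A => open A).

Definition compact_mv : Prop := mv_property (fun X A => compact_hausdorff A).

End mayer_vietoris.

(* [hom_empty] has to be required separately: it does not follow from the other
   axioms. Augmented singular homology with coefficients in an infinite
   dimensional space W satisfies all of them, vanishes on one-point spaces, and
   takes the value W on the empty space (degree -1) and on a discrete two-point
   space (degree 0); with a constant function on the latter it would refute the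
   q-tameness of compact weakly LHS sublevel set filtrations. *)
Record homology_theory (R : realType) (F : fieldType) := HomologyTheory {
  hom_functors :> top_functors F;
  hom_homotopy : forall (X Y : topologicalType) (f g : continuousType X Y),
    homotopic R f g ->
    forall (d : int) (u : hom_functors d X),
      hmap hom_functors d f u = hmap hom_functors d g u;
  hom_mayer_vietoris : open_mv hom_functors \/ compact_mv hom_functors;
  hom_bounded_below : exists n0 : int, forall n : int, n <= n0 ->
    forall (X : topologicalType) (u : hom_functors n X), u = 0;
  hom_point : forall (n : int) (X : topologicalType),
    (exists x : X, forall y : X, y = x) ->
    finite_dimensional [set: hom_functors n X];
  hom_empty : forall (n : int) (X : topologicalType),
    [set: X] = set0 -> finite_dimensional [set: hom_functors n X]
}.

Definition homologically_small (F : fieldType) (H : top_functors F)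
    (X Y : topologicalType) (g : continuousType X Y) : Prop :=
  forall n : int, finite_rank (hmap H n g).

Section sublevel_sets.
Variables (R : realType) (X : topologicalType) (f : X -> R).

Definition sublevel (t : R) : set X := f @^-1` `]-oo, t].

Lemma sublevelS (s t : R) : s < t -> sublevel s `<=` sublevel t.
Proof.
by move=> st x; rewrite /sublevel/= !in_itv/= => /le_trans; apply; exact: ltW.
Qed.

Definition compact_sublevels : Prop :=
  forall t : R, compact_hausdorff (sublevel t).

Variables (F : fieldType) (H : top_functors F).

Definition weakly_LHS : Prop :=
  forall (x : X) (V : set X) (t : R), nbhs x V -> f x < t ->
    exists (s : R) (U : set X) (st : s < t) (UV : U `<=` V),
      [/\ f x < s, nbhs x U &
          homologically_small H (incl_map (setISS (sublevelS st) UV))].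

Definition q_tame : Prop :=
  forall (d : int) (s t : R) (st : s < t),
    finite_rank (hmap H d (incl_map (sublevelS st))).

End sublevel_sets.

(* Main.v *)
Require Import Defs.
From HB Require Import structures.
From mathcomp Require Import all_boot all_order all_algebra.
From mathcomp Require Import all_classical all_reals all_analysis.
Import numFieldNormedType.Exports.
Set Implicit Arguments.
Unset Strict Implicit.
Unset Printing Implicit Defensive.
Import Order.TTheory GRing.Theory Num.Theory.
Local Open Scope classical_set_scope.
Local Open Scope ring_scope.

(** The function serves only to make [X] a locally compact Hausdorff space in
which small neighborhoods have small homology. Since the index [s] of the weak
LHS condition satisfies [f x < s], the set [sublevel f s] is a neighborhood of
[x], and the condition implies that every neighborhood [V] of [x] contains a
neighborhood [W] of [x] such that [W -> V] has finite rank in every degree; and compactness of the sublevel sets makes [X]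
locally compact Hausdorff. As [sublevel f s] is a compact subset of the interior
of [sublevel f t], the theorem is a case of the following statement, a form of
an argument of Wilder and Bredon: if [A] lies in a compact subset [C] of the
interior of [B], then [A -> B] has finite rank ([nested_finite_rank]).

The proof is by induction on the degree, which starts because homology vanishes
in low degrees. Call a compact set good if some neighborhood of it includes in
[B] with finite rank in degree [n + 1]. Points have good compact neighborhoods,
so [C] is covered by a good set as soon as the union of two good sets is good.
If [W1] and [W2] are the neighborhoods witnessing that [K1] and [K2] are good,
choose smaller neighborhoods [U1] and [U2] and compare the Mayer-Vietoris
sequences
<<
                     H_(n+1)(U1 u U2) --> H_n(U1 n U2)
                            |                  |
  H_(n+1)(W1)        H_(n+1)(W1 u W2) --> H_n(W1 n W2)
  (+) H_(n+1)(W2) -->       |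
        |                   |
  H_(n+1)(B)  ------> H_(n+1)(B)
  (+) H_(n+1)(B)
>>
The right vertical map has finite rank by induction, hence a subspace of finite
codimension in [H_(n+1)(U1 u U2)] dies in [H_n(W1 n W2)]; by exactness its image
in the homology of [W1 u W2] comes from the homology of [W1] and [W2], so its
image in the homology of [B] is finite dimensional. Thus [U1 u U2 -> B] has
finite rank ([mayer_vietoris_finite_rank]).

All sets to which Mayer-Vietoris is applied are interpolated between a compact
set and an open neighborhood of it, and may be chosen either open or compact;
the induction is therefore carried out for an abstract class [P] of sets
covering both cases. *)

(** * Subspaces of finite dimension and maps of finite rank *)

Section linear_algebra.
Variable F : fieldType.

(** Unlike [finite_dimensional], this does not require the spanning family to lie
in [S], and so passes to subsets at once; over a field the two notions agree on
linear subspaces. *)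
Definition finitely_spanned (V : lmodType F) (S : set V) : Prop :=
  exists (n : nat) (v : 'I_n -> V),
    forall u, S u -> exists c : 'I_n -> F, u = \sum_(i < n) c i *: v i.

Definition subspace_set (V : lmodType F) (S : set V) : Prop :=
  S 0 /\ forall a u v, S u -> S v -> S (a *: u + v).

Lemma finite_dimensional_spanned (V : lmodType F) (S : set V) :
  finite_dimensional S -> finitely_spanned S.
Proof. by move=> [n [v ->]]; exists n, v => u [c _ <-]; exists c. Qed.

Lemma finitely_spannedS (V : lmodType F) (S T : set V) :
  S `<=` T -> finitely_spanned T -> finitely_spanned S.
Proof. by move=> ST [n [v vT]]; exists n, v => u /ST /vT. Qed.

Lemma finitely_spanned_add (V : lmodType F) (S T U : set V) :
  finitely_spanned S -> finitely_spanned T ->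
  (forall u, U u -> exists s t, [/\ S s, T t & u = s + t]) ->
  finitely_spanned U.
Proof.
move=> [m [v vS]] [n [w wT]] UST.
exists (m + n)%N, (fun i : 'I_(m + n) =>
  match fintype.split i with inl j => v j | inr j => w j end).
move=> u /UST[s [t [/vS[c ->] /wT[d ->] ->]]].
exists (fun i : 'I_(m + n) =>
  match fintype.split i with inl j => c j | inr j => d j end).
rewrite big_split_ord /=; congr (_ + _); apply: eq_bigr => i _.
  by case: split_ordP => j /eqP; rewrite ?eq_lshift ?eq_lrshift// => /eqP ->.
by case: split_ordP => j /eqP; rewrite ?eq_rshift ?eq_rlshift// => /eqP ->.
Qed.

Lemma finitely_spanned_image (U V : lmodType F) (phi : {linear U -> V})
    (S : set U) :
  finitely_spanned S -> finitely_spanned (phi @` S).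
Proof.
move=> [n [v vS]]; exists n, (phi \o v) => _ [u /vS[c ->] <-].
by exists c; rewrite linear_sum; apply: eq_bigr => i _; rewrite linearZ.
Qed.

(** Induction on the size of the spanning family: the part [T] of [S] spanned
without the first vector [v ord0] is finite dimensional, and if [S] is larger
than [T], one element [z] of [S] with a nonzero coordinate along [v ord0]
generates it modulo [T]. *)
Lemma finitely_spanned_finite_dimensional (V : lmodType F) (S : set V) :
  subspace_set S -> finitely_spanned S -> finite_dimensional S.
Proof.
move=> + [n]; elim: n S => [|n IHn] S [S0 SP] [v vS].
  exists 0%N, v; apply/seteqP; split => u.
    by move=> /vS[c ->]; exists c.
  by move=> [c _ <-]; rewrite big_ord0.
have SD u w : S u -> S w -> S (u + w).
  by move=> Su Sw; rewrite -[u]scale1r; exact: SP.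
have SZ a u : S u -> S (a *: u).
  by move=> Su; rewrite -[_ *: _]addr0; exact: SP.
pose T := [set u | S u /\
  exists c : 'I_n -> F, u = \sum_(i < n) c i *: v (lift ord0 i)].
have [m [w Tw]] : finite_dimensional T.
  apply: IHn; last by exists (fun i => v (lift ord0 i)) => u [].
  split; first by split=> //; exists (fun=> 0); rewrite big1// => i _;
    rewrite scale0r.
  move=> a x y [Sx [c xc]] [Sy [d yd]]; split; first exact: SP.
  exists (fun i => a * c i + d i).
  rewrite xc yd scaler_sumr -big_split; apply: eq_bigr => i _.
  by rewrite scalerDl scalerA.
have [[e [Se e0]]|noe] := pselect (exists c : 'I_n.+1 -> F,
    S (\sum_(i < n.+1) c i *: v i) /\ c ord0 != 0); last first.
  exists m, w; rewrite -Tw; apply/seteqP; split => [u Su|u []//].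
  split=> //; have [c uc] := vS _ Su.
  exists (fun i => c (lift ord0 i)); rewrite uc big_ord_recl.
  have [->|c0] := eqVneq (c ord0) 0; first by rewrite scale0r add0r.
  by case: noe; exists c; rewrite -uc.
set z := \sum_(i < n.+1) e i *: v i in Se.
exists m.+1, (fun i => if unlift ord0 i is Some j then w j else z).
apply/seteqP; split => [u Su|_ [c _ <-]]; last first.
  rewrite big_ord_recl unlift_none; apply: SD; first exact: SZ.
  have : T (\sum_(i < m) c (lift ord0 i) *: w i).
    by rewrite Tw; exists (fun i => c (lift ord0 i)).
  by move=> -[Sw _]; under eq_bigr do rewrite liftK.
have [c uc] := vS _ Su; pose a := c ord0 / e ord0.
have : T (u - a *: z).
  split; first by rewrite addrC -scaleNr; exact: SP.
  exists (fun i => c (lift ord0 i) - a * e (lift ord0 i)).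
  rewrite uc /z !big_ord_recl scalerDr scalerA divfK// opprD addrACA subrr add0r.
  rewrite scaler_sumr -sumrB; apply: eq_bigr => i _.
  by rewrite scalerBl scalerA.
rewrite Tw => -[d _ ud].
exists (fun i => if unlift ord0 i is Some j then d j else a) => //.
rewrite big_ord_recl unlift_none -[RHS](subrK (a *: z)) -ud addrC; congr (_ + _).
by apply: eq_bigr => i _; rewrite liftK.
Qed.

Lemma subspace_range (U V : lmodType F) (phi : {linear U -> V}) :
  subspace_set (range phi).
Proof.
split; first by exists 0 => //; rewrite linear0.
by move=> a _ _ [u _ <-] [w _ <-]; exists (a *: u + w) => //; rewrite linearP.
Qed.

Lemma finite_rankP (U V : lmodType F) (phi : {linear U -> V}) :
  finite_rank phi <-> finitely_spanned (range phi).
Proof.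
split; first exact: finite_dimensional_spanned.
by apply: finitely_spanned_finite_dimensional; exact: subspace_range.
Qed.

Lemma finite_rank_factor (T U V W : lmodType F) (f : {linear T -> U})
    (phi : {linear U -> V}) (g : {linear V -> W}) (psi : {linear T -> W}) :
  finite_rank phi -> (forall u, psi u = g (phi (f u))) -> finite_rank psi.
Proof.
move=> /finite_rankP fphi psiE; apply/finite_rankP.
apply: finitely_spannedS (finitely_spanned_image g fphi) => _ [u _ <-].
by rewrite psiE; exists (phi (f u)) => //; exists (f u).
Qed.

(** The kernel of [beta] has finite codimension in [U]: together with lifts [e] of
finitely many vectors spanning the image of [beta], it spans [U], so that
[alpha] adds only the span of the [alpha (e i)] to the image of the kernel. *)
Lemma finite_rank_ker (U V W : lmodType F) (alpha : {linear U -> V})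
    (beta : {linear U -> W}) :
  finite_rank beta -> finitely_spanned (alpha @` [set u | beta u = 0]) ->
  finite_rank alpha.
Proof.
move=> [n [w betaw]] falpha; apply/finite_rankP.
have /choice[e eP] i : exists u, beta u = w i.
  suff [u _ <-] : range beta (w i) by exists u.
  rewrite betaw; exists (fun j => (j == i)%:R) => //.
  rewrite (bigD1 i)//= eqxx scale1r big1 ?addr0// => j /negbTE ->.
  by rewrite scale0r.
apply: (@finitely_spanned_add _
  (range (fun c : 'I_n -> F => \sum_(i < n) c i *: alpha (e i)))) falpha _.
  by exists n, (alpha \o e) => _ [c _ <-]; exists c.
move=> _ [u _ <-].
have : range beta (beta u) by exists u.
rewrite betaw => -[c _ uc].
exists (\sum_(i < n) c i *: alpha (e i)), (alpha (u - \sum_(i < n) c i *: e i)).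
split; first by exists c.
- exists (u - \sum_(i < n) c i *: e i) => //=.
  rewrite linearB linear_sum -uc; apply/eqP; rewrite subr_eq0; apply/eqP.
  by apply: eq_bigr => i _; rewrite linearZ eP.
- rewrite linearB linear_sum addrC.
  under [X in _ - X]eq_bigr do rewrite linearZ.
  by rewrite subrK.
Qed.

End linear_algebra.

(** * Compact sets and their neighborhoods *)

(** Compactness as an induction principle: a family closed under finite unions
that contains a neighborhood of each point of [K] contains a set covering [K]. *)
Lemma compact_directed_cover (T : topologicalType) (K : set T)
    (G : set (set T)) :
  compact K -> G set0 -> (forall A B, G A -> G B -> G (A `|` B)) ->
  (forall x, K x -> exists2 A, G A & nbhs x A) ->
  exists2 A, G A & K `<=` A.
Proof.
move=> /compact_near_coveringP cptK G0 GU GK.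
(* the filter of sets containing all members of the directed family [G] from
   some member on *)
pose above := filter_from G (fun A => [set B | G B /\ A `<=` B]).
have above_filter : Filter above.
  apply: filter_from_filter; first by exists set0.
  move=> A B GA GB; exists (A `|` B); first exact: GU.
  by move=> C [GC ABC]; split; split=> // x ?; apply: ABC; [left|right].
have [x /GK[A GA xA]|A GA KA] := cptK _ above (fun B y => B y) above_filter.
  by exists (A, [set B | G B /\ A `<=` B]);
    [split=> //; exists A | move=> [y B] [/= Ay [_]]; exact].
by exists A => //; apply: (KA A); split.
Qed.

(** The compact set in between makes finite rank of [A -> B] a local question. *)
Definition nested (T : topologicalType) (A B : set T) : Prop :=
  exists2 C, compact C & A `<=` C /\ C `<=` B^°.

Lemma nested_sub (T : topologicalType) (A B : set T) : nested A B -> A `<=` B.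
Proof.
by move=> [C _ [subAC CB]]; apply: subset_trans subAC (subset_trans CB _);
  exact: interior_subset.
Qed.

Lemma nested_setI (T : topologicalType) (A1 A2 B1 B2 : set T) :
  hausdorff_space T ->
  nested A1 B1 -> nested A2 B2 -> nested (A1 `&` A2) (B1 `&` B2).
Proof.
move=> T2 [C1 cC1 [A1C CB1]] [C2 cC2 [A2C CB2]]; exists (C1 `&` C2).
  by apply: compact_closedI => //; exact: compact_closed.
by rewrite interiorI; split; exact: setISS.
Qed.

Definition locally_compact_hausdorff (T : topologicalType) : Prop :=
  hausdorff_space T /\ forall x : T, exists2 C, compact C & nbhs x C.

(** Each point has small compact neighborhoods, by regularity of compact Hausdorff
spaces; finitely many of them cover [K]. *)
Lemma compact_between (T : topologicalType) (K V : set T) :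
  locally_compact_hausdorff T -> compact K -> K `<=` V^° ->
  exists2 C, compact C & K `<=` C^° /\ C `<=` V^°.
Proof.
move=> [T2 Tlc] cK KV.
have loc (O : set T) x : open O -> O x ->
    exists2 C, compact C & nbhs x C /\ C `<=` O.
  move=> oO Ox; have [L cL xL] := Tlc x.
  have : nbhs x (O `&` L) by apply: filterI => //; exact: open_nbhs_nbhs.
  move=> /(compact_regular T2 cL xL)[B xB BOL].
  exists (closure B); last first.
    by split; [exact: filterS (@subset_closure _ B) xB | move=> y /BOL[]].
  apply: subclosed_compact cL _; first exact: closed_closure.
  by move=> y /BOL[].
have [| | |A [C cC [subAC CV]] KA] := @compact_directed_cover T K
  [set A | exists2 C, compact C & A `<=` C^° /\ C `<=` V^°] cK.
- by exists set0; [exact: compact0 | split].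
- move=> A B [C cC [subAC CV]] [D cD [BD DV]]; exists (C `|` D).
    exact: compactU.
  split; last by rewrite subUset.
  by apply: subset_trans (@interiorU _ _ _) => //; exact: setUSS.
- move=> x /KV Vx; have [C cC [xC CV]] := loc _ _ (open_interior V) Vx.
  exists C^°; last exact: nbhs_interior.
  by exists C => //; split=> //; exact: subset_refl.
- by exists C => //; split=> //; exact: subset_trans KA subAC.
Qed.

(** * Subspaces as topological spaces *)

Section subspace_types.
Context {X : topologicalType}.

Lemma set_val_in (A : set X) (a : A) : A (set_val a).
Proof. exact: set_mem (valP a). Qed.

Lemma set_val_inj (A : set X) : injective (@set_val X A).
Proof. exact: val_inj. Qed.

Lemma nbhs_set_type (A : set X) (a : A) (V : set A) :
  nbhs a V <-> exists2 W, nbhs (set_val a) W & set_val @^-1` W `<=` V.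
Proof.
split.
  move=> [_ [[W oW <-] Wa] WV]; exists W => //; exact: open_nbhs_nbhs.
by move=> [W aW WV]; apply: filterS WV _; exact: set_val_continuous.
Qed.

Lemma hausdorff_set_type (A : set X) : hausdorff_space X -> hausdorff_space A.
Proof.
move=> X2 p q pq; apply: set_val_inj; apply: X2 => U V pU qV.
have [x [Ux Vx]] := pq _ _ (set_val_continuous pU) (set_val_continuous qV).
by exists (set_val x).
Qed.

Lemma compact_set_type (A : set X) : compact A <-> compact [set: A].
Proof.
split=> [cA F FF _|cA]; last first.
  have -> : A = set_val @` [set: A].
    apply/seteqP; split=> [x Ax|_ [a _ <-]]; last exact: (set_val_in a).
    by exists (exist _ x (mem_set Ax)).
  apply: continuous_compact cA; apply: continuous_subspaceT.
  exact: set_val_continuous.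
have AF : F (set_val @^-1` A) by apply: filterE => a; exact: (set_val_in a).
have [x [Ax xF]] := cA (set_val @ F) _ AF.
exists (exist _ x (mem_set Ax)); split=> // U V FU /nbhs_set_type[W xW WV].
have FU' : F (set_val @^-1` (set_val @` U)) by apply: filterS FU => a; exists a.
have [_ [[a Ua <-] Wa]] := xF (set_val @` U) W FU' xW.
by exists a; split=> //; exact: WV.
Qed.

End subspace_types.

(** * The Mayer-Vietoris step *)

(** A continuous map into [X] with values in [A] as a map into the subspace [A];
it compares the intersection of two sets of [X] with the iterated subspace
which the Mayer-Vietoris axiom attaches to their traces on the union. *)
Section lift_map.
Context {Z X : topologicalType} (A : set X) (g : continuousType Z X).
Hypothesis gA : forall z, A (g z).

Definition lift_map (z : Z) : A := exist _ (g z) (mem_set (gA z)).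

Lemma lift_map_continuous : continuous lift_map.
Proof.
by apply: (@continuous_comp_initial A Z X set_val lift_map) => z; exact: cts_fun.
Qed.

HB.instance Definition _ := isContinuous.Build Z A lift_map lift_map_continuous.

End lift_map.

Section mayer_vietoris_step.
Variables (F : fieldType) (H : top_functors F).

Definition finite_rank_incl (n : int) (X : topologicalType) (A B : set X) :=
  forall AB : A `<=` B, finite_rank (hmap H n (incl_map AB)).

Lemma hmap_eq (n : int) (X Y : topologicalType) (f g : continuousType X Y) u :
  f =1 g -> hmap H n f u = hmap H n g u.
Proof. by move=> /continuousEP ->. Qed.

Lemma hmap_factor (n : int) (Z X Y T : topologicalType)
    (a : continuousType Z X) (g : continuousType X Y) (b : continuousType Y T)
    (f : continuousType Z T) :
  finite_rank (hmap H n g) -> (forall z, f z = b (g (a z))) ->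
  finite_rank (hmap H n f).
Proof.
move=> gfin fE; apply: (finite_rank_factor (f := hmap H n a) (g := hmap H n b)
  gfin) => u.
by rewrite -!hmap_comp; exact: hmap_eq.
Qed.

Lemma finite_rank_inclS (n : int) (X : topologicalType) (A A' B B' : set X) :
  A' `<=` A -> B `<=` B' -> A `<=` B ->
  finite_rank_incl n A B -> finite_rank_incl n A' B'.
Proof.
move=> A'A BB' AB fAB A'B'.
apply: (hmap_factor (a := incl_map A'A) (b := incl_map BB') (fAB AB)) => x.
exact: val_inj.
Qed.

Variable P : forall X : topologicalType, set X -> Prop.
(** The class [P] stands for the open sets or the compact Hausdorff ones. The
Mayer-Vietoris axiom speaks of sets covering the whole space, so that sets [A]
of [X] enter it through their traces on a union [W]. *)
Hypothesis P_subspace : forall (X : topologicalType) (A W : set X),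
  hausdorff_space X -> A `<=` W -> P A -> P (set_val @^-1` A : set W).
Hypothesis P_mv : mv_property H P.

(** On the homology of [U1 `|` U2], the connecting map of [W1 `|` W2] has finite
rank, because by naturality it factors through [U1 `&` U2 -> W1 `&` W2]; by
exactness, the classes in its kernel come from [W1] and [W2], whose images in
the homology of [N] are finite dimensional. *)
Lemma mayer_vietoris_finite_rank (n : int) (X : topologicalType)
    (U1 U2 W1 W2 N : set X) :
  hausdorff_space X -> P U1 -> P U2 -> P W1 -> P W2 ->
  U1 `<=` W1 -> U2 `<=` W2 -> W1 `<=` N -> W2 `<=` N ->
  finite_rank_incl n (U1 `&` U2) (W1 `&` W2) ->
  finite_rank_incl (n + 1) W1 N -> finite_rank_incl (n + 1) W2 N ->
  finite_rank_incl (n + 1) (U1 `|` U2) N.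
Proof.
move=> X2 PU1 PU2 PW1 PW2 UW1 UW2 W1N W2N fI fW1 fW2 UN.
have [delta [delta_exact delta_nat]] := P_mv.
pose U := U1 `|` U2; pose W := W1 `|` W2.
have UW : U `<=` W by exact: setUSS.
have WN : W `<=` N by rewrite subUset.
pose A1 : set U := set_val @^-1` U1; pose A2 : set U := set_val @^-1` U2.
pose B1 : set W := set_val @^-1` W1; pose B2 : set W := set_val @^-1` W2.
have mvA : mv_triple P A1 A2.
  split; [|by apply: P_subspace => //; exact: subsetUl
          |by apply: P_subspace => //; exact: subsetUr].
  by apply/seteqP; split=> // a _; exact: (set_val_in a).
have mvB : mv_triple P B1 B2.
  split; [|by apply: P_subspace => //; exact: subsetUl
          |by apply: P_subspace => //; exact: subsetUr].
  by apply/seteqP; split=> // a _; exact: (set_val_in a).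
pose i := incl_map UW; pose j := incl_map WN.
have iA1 : A1 `<=` i @^-1` B1 by move=> a; exact: UW1.
have iA2 : A2 `<=` i @^-1` B2 by move=> a; exact: UW2.
have fdelta : finite_rank (delta W B1 B2 n \o hmap H (n + 1) i).
  pose a : continuousType (A1 `&` A2) (U1 `&` U2) :=
    @lift_map _ _ (U1 `&` U2) (@set_val X U \o @set_val U (A1 `&` A2))
      (@set_val_in U (A1 `&` A2)).
  pose incW : continuousType (W1 `&` W2) W :=
    @lift_map _ _ W (@set_val X (W1 `&` W2))
      (fun z => or_introl (@set_val_in X (W1 `&` W2) z).1).
  pose b : continuousType (W1 `&` W2) (B1 `&` B2) :=
    @lift_map _ _ (B1 `&` B2) incW (@set_val_in X (W1 `&` W2)).
  have fr : finite_rank (hmap H n (restr_map (setI_preimage iA1 iA2))).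
    apply: (hmap_factor (a := a) (b := b) (fI (setISS UW1 UW2))) => x.
    by do 2!apply: val_inj.
  apply: (finite_rank_factor (f := delta U A1 A2 n) (g := idfun) fr) => u.
  exact: delta_nat.
have fB1 : finite_rank (hmap H (n + 1) (j \o @set_val W B1)).
  pose b : continuousType B1 W1 :=
    @lift_map _ _ W1 (@set_val X W \o @set_val W B1) (@set_val_in W B1).
  by apply: (hmap_factor (a := b) (b := idfun) (fW1 W1N)) => x; exact: val_inj.
have fB2 : finite_rank (hmap H (n + 1) (j \o @set_val W B2)).
  pose b : continuousType B2 W2 :=
    @lift_map _ _ W2 (@set_val X W \o @set_val W B2) (@set_val_in W B2).
  by apply: (hmap_factor (a := b) (b := idfun) (fW2 W2N)) => x; exact: val_inj.
apply: (finite_rank_ker fdelta).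
have [_ + _] := delta_exact _ _ _ mvB n.
rewrite /exact_at => ker_delta.
move/finite_rankP in fB1; move/finite_rankP in fB2.
apply: (finitely_spanned_add fB1 fB2) => _ [u u0 <-].
have : [set v | delta W B1 B2 n v = 0] (hmap H (n + 1) i u) by [].
rewrite -ker_delta => -[[v w] _ vw].
exists (hmap H (n + 1) (j \o @set_val W B1) v).
exists (hmap H (n + 1) (j \o @set_val W B2) (- w)).
split; [by exists v | by exists (- w)|].
rewrite !hmap_comp !linearN -linearB.
transitivity (hmap H (n + 1) j (hmap H (n + 1) i u)).
  by rewrite -hmap_comp; apply: hmap_eq => x; exact: val_inj.
by congr (hmap _ _ _ _); rewrite -vw.
Qed.

End mayer_vietoris_step.

(** * Finite rank for nested sets *)

Definition locally_homologically_small (F : fieldType) (H : top_functors F)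
    (X : topologicalType) : Prop :=
  forall (x : X) (V : set X), nbhs x V ->
    exists W, [/\ W `<=` V, nbhs x W & forall n, finite_rank_incl H n W V].

Section nested_finite_rank.
Variables (F : fieldType) (H : top_functors F).
Variable P : forall X : topologicalType, set X -> Prop.
Hypothesis P_subspace : forall (X : topologicalType) (A W : set X),
  hausdorff_space X -> A `<=` W -> P A -> P (set_val @^-1` A : set W).
Hypothesis P_between : forall (X : topologicalType) (K V : set X),
  locally_compact_hausdorff X -> compact K -> K `<=` V^° ->
  exists M, [/\ P M, K `<=` M^° & nested M V].
Hypothesis P_mv : mv_property H P.
Hypothesis H_empty : forall (n : int) (X : topologicalType),
  [set: X] = set0 -> finite_dimensional [set: H n X].

(** Good compact sets are those with a neighborhood of finite rank in [B]; they
are closed under union by the Mayer-Vietoris step. The empty set is good because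
its homology is finite dimensional. *)
Lemma nested_finite_rank_succ (n : int) (X : topologicalType) :
  locally_compact_hausdorff X -> locally_homologically_small H X ->
  (forall A B : set X, nested A B -> finite_rank_incl H n A B) ->
  forall A B : set X, nested A B -> finite_rank_incl H (n + 1) A B.
Proof.
move=> Xlc Xsmall IH A N [C cC [subAC CN]].
pose good := [set K : set X | compact K /\
  exists W, [/\ K `<=` W^°, W `<=` N & finite_rank_incl H (n + 1) W N]].
have [|||K [_ [W [KW WN fW]]] CK] := compact_directed_cover (G := good) cC.
- split; first exact: compact0.
  exists set0; split=> // N0; apply/finite_rankP.
  have : finite_dimensional [set: H (n + 1) (set0 : set X)].
    by apply: H_empty; apply/seteqP; split=> // x _; exact: (set_val_in x).
  by move/finite_dimensional_spanned; exact: finitely_spanned_image.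
- move=> K1 K2 [cK1 [W1 [KW1 WN1 fW1]]] [cK2 [W2 [KW2 WN2 fW2]]].
  split; first exact: compactU.
  (* Two sets are inserted between [Ki] and [Wi]: the larger one [Mi] takes the
     place of [Wi] as a member of [P], and [Li] is nested in it, so that the
     induction hypothesis applies to the intersections. *)
  have [M1 [PM1 KM1 MW1]] := P_between Xlc cK1 KW1.
  have [M2 [PM2 KM2 MW2]] := P_between Xlc cK2 KW2.
  have [L1 [PL1 KL1 LM1]] := P_between Xlc cK1 KM1.
  have [L2 [PL2 KL2 LM2]] := P_between Xlc cK2 KM2.
  have MN1 : M1 `<=` N := subset_trans (nested_sub MW1) WN1.
  have MN2 : M2 `<=` N := subset_trans (nested_sub MW2) WN2.
  exists (L1 `|` L2); split.
  + by apply: subset_trans (@interiorU _ _ _) => //; exact: setUSS.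
  + by rewrite subUset; split; [apply: subset_trans MN1|apply: subset_trans MN2];
      exact: nested_sub.
  + apply: (mayer_vietoris_finite_rank P_subspace P_mv Xlc.1 PL1 PL2 PM1 PM2) => //.
    * exact: nested_sub.
    * exact: nested_sub.
    * by apply: IH; exact: (nested_setI Xlc.1).
    * exact: finite_rank_inclS (nested_sub MW1) _ WN1 fW1.
    * exact: finite_rank_inclS (nested_sub MW2) _ WN2 fW2.
- move=> x /CN Nx; have [W [WN xW fW]] := Xsmall x N Nx.
  have xW' : [set x] `<=` W^° by move=> _ ->.
  have [K cK [xK KW]] := compact_between Xlc (@compact_set1 _ x) xW'.
  by exists K; [split=> //; exists W | exact: xK].
- apply: finite_rank_inclS fW => //; apply: subset_trans subAC _.
  by apply: subset_trans CK (subset_trans KW _); exact: interior_subset.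
Qed.

Lemma nested_finite_rank (n0 : int) (X : topologicalType) :
  (forall n, n <= n0 -> forall (Y : topologicalType) (u : H n Y), u = 0) ->
  locally_compact_hausdorff X -> locally_homologically_small H X ->
  forall (n : int) (A B : set X), nested A B -> finite_rank_incl H n A B.
Proof.
move=> H0 Xlc Xsmall n.
have low m : m <= n0 -> forall A B : set X, finite_rank_incl H m A B.
  move=> mn0 A B AB; apply/finite_rankP.
  exists 0%N, (fun=> 0) => u _; exists (fun=> 0).
  by rewrite big_ord0; exact: H0.
have [/low fn A B _|/ltW n0n] := leP n n0; first exact: fn.
have -> : n = n0 + `|n - n0|%N by rewrite gez0_abs ?subr_ge0// addrCA subrr addr0.
elim: `|n - n0|%N => [|k IHk]; first by rewrite addr0 => A B _; exact: low.
by rewrite -addn1 PoszD addrA; exact: nested_finite_rank_succ.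
Qed.

End nested_finite_rank.

(** * Open sets and compact Hausdorff sets *)

Lemma open_subspace (X : topologicalType) (A W : set X) :
  open A -> open (set_val @^-1` A : set W).
Proof. by move=> oA; exists A. Qed.

Lemma compact_hausdorff_subspace (X : topologicalType) (A W : set X) :
  hausdorff_space X -> A `<=` W -> compact_hausdorff A ->
  compact_hausdorff (set_val @^-1` A : set W).
Proof.
move=> X2 AW [cA _]; split; last by do 2!apply: hausdorff_set_type.
apply: (compact_set_type _).1.
have -> : set_val @^-1` A = incl_map AW @` [set: A].
  apply/seteqP; split=> [w Aw|_ [a _ <-]]; last exact: (set_val_in a).
  by exists (exist _ (set_val w) (mem_set Aw)) => //; exact: val_inj.
apply: (@continuous_compact A W (incl_map AW)) cA.
by apply: continuous_subspaceT; exact: cts_fun.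
Qed.

Lemma open_between (X : topologicalType) (K V : set X) :
  locally_compact_hausdorff X -> compact K -> K `<=` V^° ->
  exists M : set X, [/\ open M, K `<=` M^° & nested M V].
Proof.
move=> Xlc cK KV; have [C cC [KC CV]] := compact_between Xlc cK KV.
exists C^°; split; first exact: open_interior.
  by have /interior_id -> := open_interior C.
by exists C => //; split=> //; exact: interior_subset.
Qed.

Lemma compact_hausdorff_between (X : topologicalType) (K V : set X) :
  locally_compact_hausdorff X -> compact K -> K `<=` V^° ->
  exists M : set X, [/\ compact_hausdorff M, K `<=` M^° & nested M V].
Proof.
move=> Xlc cK KV; have [C cC [KC CV]] := compact_between Xlc cK KV.
exists C; split=> //; last by exists C => //; split.
by split; [exact: (compact_set_type _).1 cC|exact: hausdorff_set_type Xlc.1].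
Qed.

(** * Sublevel sets *)

Section sublevels.
Variables (R : realType) (X : topologicalType) (f : X -> R).
Hypothesis f_continuous : continuous f.

Lemma sublevel_interior (x : X) (t : R) : f x < t -> (sublevel f t)^° x.
Proof.
move=> fxt; apply: filterS (f_continuous (@lt_nbhsl _ _ _ fxt)) => y /=.
by rewrite /sublevel/= !in_itv/= => /ltW.
Qed.

(** Any two points are interior to a common compact Hausdorff sublevel set, which
separates them. *)
Lemma sublevels_locally_compact :
  compact_sublevels f -> locally_compact_hausdorff X.
Proof.
move=> f_compact; split; last first.
  move=> x; exists (sublevel f (f x + 1)).
    exact: (compact_set_type _).2 (f_compact (f x + 1)).1.
  by apply: sublevel_interior; rewrite ltrDl.
move=> x y xy; pose t := Num.max (f x) (f y) + 1.
have xt : f x < t by rewrite ltr_pwDr// le_max lexx.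
have yt : f y < t by rewrite ltr_pwDr// le_max lexx orbT.
have tx := nbhs_singleton (sublevel_interior xt).
have ty := nbhs_singleton (sublevel_interior yt).
pose x' : sublevel f t := exist _ x (mem_set tx).
pose y' : sublevel f t := exist _ y (mem_set ty).
suff : x' = y' by move=> /(congr1 set_val).
apply: (f_compact t).2 => U V /nbhs_set_type[U' xU UU] /nbhs_set_type[V' yV VV].
have [z [[Uz tz] Vz]] := xy _ _ (filterI xU (sublevel_interior xt)) yV.
by exists (exist _ z (mem_set tz)); split; [exact: UU|exact: VV].
Qed.

(** The indices of the weak LHS condition disappear: [sublevel f s] is a
neighborhood of [x] when [f x < s], so intersecting with it only shrinks the
neighborhood, and the upper bound [f x + 1] may be forgotten by enlarging the
target. *)
Lemma weakly_LHS_locally_small (F : fieldType) (H : top_functors F) :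
  weakly_LHS f H -> locally_homologically_small H X.
Proof.
move=> f_LHS x V xV.
have [|s [U [st [UV [fxs xU sU]]]]] := f_LHS x V (f x + 1) xV.
  by rewrite ltrDl.
exists (sublevel f s `&` U); split.
- by move=> y [_ /UV].
- by apply: filterI => //; exact: sublevel_interior.
- move=> n sUV.
  apply: (hmap_factor (a := idfun)
    (b := incl_map (@subIsetr _ (sublevel f (f x + 1)) V)) (sU n)) => y.
  exact: val_inj.
Qed.

End sublevels.

Theorem corollary4p12 (R : realType) (F : fieldType) (H : homology_theory R F)
    (X : topologicalType) (f : X -> R) (f_continuous : continuous f)
    (f_compact : compact_sublevels f) (f_LHS : weakly_LHS f H) :
  q_tame f H.
Proof.
move=> d s t st.
have Xlc := sublevels_locally_compact f_continuous f_compact.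
have Xsmall := weakly_LHS_locally_small f_continuous f_LHS.
have [n0 H0] := hom_bounded_below H.
have st_nested : nested (sublevel f s) (sublevel f t).
  exists (sublevel f s).
    exact: (compact_set_type _).2 (f_compact s).1.
  split=> // x; rewrite /sublevel/= in_itv/= => fxs.
  by apply: sublevel_interior => //; exact: le_lt_trans st.
have [Hmv|Hmv] := hom_mayer_vietoris H.
  exact: (nested_finite_rank (fun X A W _ _ => @open_subspace X A W)
    open_between Hmv (@hom_empty _ _ H) H0 Xlc Xsmall d st_nested).
exact: (nested_finite_rank compact_hausdorff_subspace
  compact_hausdorff_between Hmv (@hom_empty _ _ H) H0 Xlc Xsmall d st_nested).
Qed.
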